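(* Let $W(\Lambda_0)$ and $W(\Lambda_1)$ be the principal subspaces of the level $1$ standard $A_1^{(1)}$-modules $L(\Lambda_0)$ and $L(\Lambda_1)$, and let $\chi_0(x,q)$ and $\chi_1(x,q)$ be their graded dimensions with respect to charge (variable $x$) and weight (variable $q$). Then $$\chi_0(x,q)=\sum_{n\ge0}\frac{x^nq^{n^2}}{(q)_n},\qquad \chi_1(x,q)=x^{1/2}q^{1/4}\sum_{n\ge0}\frac{x^nq^{n^2+n}}{(q)_n},$$ where $(q)_n=(1-q)(1-q^2)\cdots(1-q^n)$.
   Context: Let $\mathfrak{g}=\mathfrak{sl}(2,\mathbb{C})$ with Cartan subalgebra $\mathfrak{h}=\mathbb{C}h$, form $\langle x,y\rangle=\mathrm{tr}(xy)$, and positive root $\alpha$; via the form, $\mathfrak{h}^*$ is identified with $\mathfrak{h}$, so that $\alpha=h$ and $\langle\alpha,\alpha\rangle=2$. Let $Q=\mathbb{Z}\alpha$ and $P=\frac12\mathbb{Z}\alpha$, with group algebras $\mathbb{C}[Q]\subset\mathbb{C}[P]$ having bases $\{e^\mu\}$ (so $e^\lambda e^\mu=e^{\lambda+\mu}$). Fock space: $M(1)=\mathbb{C}[h(-1),h(-2),\dots]$ is the polynomial algebra on which $h(-n)$ ($n>0$) acts by multiplication and $h(n)$ ($n>0$) acts as the derivation $2n\,\partial/\partial h(-n)$; thus $[h(m),h(n)]=2m\,\delta_{m+n,0}$. Put $V_P=M(1)\otimes\mathbb{C}[P]$, $V_Q=M(1)\otimes\mathbb{C}[Q]$, $V_{Q+\alpha/2}=M(1)\otimes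 e^{\alpha/2}\mathbb{C}[Q]$. The operators $h(n)$, $n\neq0$, act on the first factor, and $h(0)$ acts on the second factor by $h(0)e^\lambda=\langle h,\lambda\rangle e^\lambda$. For $\lambda=c\,\alpha$ write $\lambda(n)=c\,h(n)$. On $V_P$, $e^\lambda$ also denotes the operator $1\otimes(\text{multiplication by }e^\lambda)$, and $x^\lambda$ denotes the operator $1\otimes x^\lambda$ with $x^\lambda\cdot e^\mu=x^{\langle\lambda,\mu\rangle}e^\mu$. A vector $1\otimes e^\lambda$ is written $e^\lambda$. Vertex operators: for $\lambda\in P$, $$Y(e^\lambda,x)=E^-(-\lambda,x)E^+(-\lambda,x)e^\lambda x^\lambda,$$ $$E^-(\lambda,x)=\exp\Big(\sum_{n\le-1}\frac{\lambda(n)}{n}x^{-n}\Big),\qquad E^+(\lambda,x)=\exp\Big(\sum_{n\ge1}\frac{\lambda(n)}{n}x^{-n}\Big).$$ For $m\in\mathbb{Z}$ let $x_\alpha(m)$ be the coefficient of $x^{-m-1}$ in $Y(e^\alpha,x)$, an operator on $V_P$. (With $x_{\pm\alpha}(m)$ the coefficient of $x^{-m-1}$ in $Y(e^{\pm\alpha},x)$, $V_P$ becomes a level $1$ module for the affine Lie algebra $\widehat{\mathfrak{sl}(2)}$, and $V_Q$, $V_{Q+\alpha/2}$ are the irreducible highest weight modules $L(\Lambda_0)$, $L(\Lambda_1)$ with highest weight vectors $v_{\Lambda_0}=1=1\otimes1$ and $v_{\Lambda_1}=e^{\alpha/2}$.) The operators $x_\alpha(m)$, $m\in\mathbb{Z}$,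 commute with one another. Principal subspaces: $W(\Lambda_j)=U(\mathfrak{n}_+\otimes\mathbb{C}[t,t^{-1}])v_{\Lambda_j}$, $j=0,1$, where $\mathfrak{n}_+=\mathbb{C}x_\alpha$; i.e. $W(\Lambda_j)$ is the linear span of all vectors $x_\alpha(m_1)\cdots x_\alpha(m_k)v_{\Lambda_j}$ with $k\ge0$, $m_1,\dots,m_k\in\mathbb{Z}$. Gradings: $V_P$ is graded by weight (the eigenvalue of the Virasoro operator $L(0)$), where $h(-n_1)\cdots h(-n_k)\otimes e^\lambda$ ($n_i>0$) has weight $n_1+\cdots+n_k+\frac12\langle\lambda,\lambda\rangle$, and by charge, the eigenvalue of $\frac12 h(0)$ (so $M(1)\otimes e^{c\alpha}$ has charge $c$). The principal subspaces are doubly graded subspaces; $W(\Lambda_j)_{r,s}$ denotes the subspace of charge $r$ and weight $s$. The graded dimensions are $$\chi_j(x,q)=\mathrm{tr}|_{W(\Lambda_j)}x^{\alpha/2}q^{L(0)}=\sum_{r\in\frac12\mathbb{Z},\,s\in\frac14\mathbb{Z}}\dim W(\Lambda_j)_{r,s}\,x^rq^s,\qquad j=0,1,$$ as formal series in powers of $x^{1/2}$ and $q^{1/4}$; the factors $1/(q)_n$ are expanded as power series in $q$. *)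

(* Defs.v *)
From HB Require Import structures.
From mathcomp Require Import all_boot all_order all_algebra finmap.
From mathcomp Require Import monalg complex.
From mathcomp Require Import boolp classical_sets functions cardinality fsbigop reals.

Set Implicit Arguments.
Unset Strict Implicit.
Unset Printing Implicit Defensive.

Import Order.TTheory GRing.Theory Num.Theory.

Local Open Scope ring_scope.
Local Open Scope classical_set_scope.

(** * The lattice P and the space V_P

    The integer k stands for the weight k*alpha/2 of P, so that alpha = h is 2.
    The monomial m : {cmonom nat} stands for the product of the
    h(-(i+1))^(m i), i : nat, in M(1).  Hence (m, k) runs over the basis
    m (x) e^(k alpha/2) of V_P = M(1) (x) C[P]. *)

Definition form (l k : int) : rat := l%:~R * k%:~R / 2.

Notation VP F := {malg F[({cmonom nat} * int)%type]}.

Definition basisv (F : numFieldType) (m : {cmonom nat}) (k : int) : VP F :=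
  << (m, k) >>.

Definition evec (F : numFieldType) (k : int) : VP F := basisv F (onecm nat) k.

Definition linext (F : numFieldType) (f : {cmonom nat} -> int -> VP F)
    (v : VP F) : VP F :=
  \sum_(b <- msupp v) v@_b *: f b.1 b.2.

(** * Operators *)

(* In the case n = i.+1 below, divcm m (ucm i) is the monomial m / h(-n);
   when h(-n) does not occur in m it is junk, but the scalar m i vanishes. *)
Definition heis (F : numFieldType) (n : int) : VP F -> VP F :=
  linext (fun m k =>
    match n with
    | Posz 0 => k%:~R *: basisv F m k
    | Posz i.+1 => (2 * i.+1 * m i)%:R *: basisv F (divcm m (ucm i)) k
    | Negz i => basisv F (mulcm (ucm i) m) k
    end).

(* lambda(n) for lambda = l*alpha/2 *)
Definition lamop (F : numFieldType) (l n : int) (v : VP F) : VP F :=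
  (l%:~R / 2) *: heis n v.

(* the operators e^lambda and (coefficient of x^d in) x^lambda *)
Definition eop (F : numFieldType) (l : int) : VP F -> VP F :=
  linext (fun m k => basisv F m (l + k)).

Definition xop (F : numFieldType) (l : int) (d : rat) : VP F -> VP F :=
  linext (fun m k => if form l k == d then basisv F m k else 0).

(* Formal power series in one variable z whose coefficients are operators:
   A p is the coefficient of z^p. *)
Definition opser (F : numFieldType) : Type := nat -> VP F -> VP F.

Definition opone (F : numFieldType) : opser F :=
  fun p v => if p == 0%N then v else 0.

Definition opmul (F : numFieldType) (A B : opser F) : opser F :=
  fun p v => \sum_(i < p.+1) A i (B (p - i)%N v).

(* exp of a series A with A 0 = 0: then A^j has no term of degree p < j, so
   truncating at j <= p gives the full coefficient of z^p. *)
Definition opexp (F : numFieldType) (A : opser F) : opser F :=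
  fun p v => \sum_(j < p.+1) (j`!%:R)^-1 *: iter j (opmul A) (@opone F) p v.

(* E^-(lambda, x), a series in z = x *)
Definition Eminus (F : numFieldType) (l : int) : opser F :=
  opexp (fun p v =>
    if p == 0%N then 0 else ((- p%:Z)%:~R)^-1 *: lamop l (- p%:Z) v).

(* E^+(lambda, x), a series in z = x^-1 *)
Definition Eplus (F : numFieldType) (l : int) : opser F :=
  opexp (fun p v => if p == 0%N then 0 else (p%:R)^-1 *: lamop l p%:Z v).

(* The coefficient of x^e in Y(e^lambda, x) applied to v: E^-, E^+ and x^lambda
   contribute x^p, x^-q and x^(e - p + q).  On each v only finitely many
   (p, q) give a nonzero term, since E^+ is locally finite and x^lambda v has
   finitely many terms. *)
Definition Ycoef (F : numFieldType) (l : int) (e : rat) (v : VP F) : VP F :=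
  \sum_(pq \in [set: nat * nat])
    Eminus (- l) pq.1
      (Eplus (- l) pq.2 (eop l (xop l (e - pq.1%:R + pq.2%:R) v))).

Definition xalpha (F : numFieldType) (m : int) : VP F -> VP F :=
  Ycoef 2 (- m%:~R - 1).

(** * Principal subspaces and their gradings *)

(* v_(Lambda_0) = 1 and v_(Lambda_1) = e^(alpha/2) *)
Definition vLambda (F : numFieldType) (j : 'I_2) : VP F := evec F j%:Z.

Definition principal (F : numFieldType) (j : 'I_2) : set (VP F) :=
  [set v | exists s : seq (F * seq int),
    v = \sum_(t <- s) t.1 *: foldr (@xalpha F) (vLambda F j) t.2].

Definition charge (b : {cmonom nat} * int) : rat := b.2%:~R / 2.

Definition weight (b : {cmonom nat} * int) : rat :=
  (\sum_(i <- finsupp b.1) b.1 i * i.+1)%N%:R + form b.2 b.2 / 2.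

Definition homogeneous (F : numFieldType) (r s : rat) : set (VP F) :=
  [set v | forall b, b \in msupp v -> charge b = r /\ weight b = s].

Definition principal_hom (F : numFieldType) (j : 'I_2) (r s : rat) :
  set (VP F) := principal j `&` homogeneous r s.

Definition has_dim (F : numFieldType) (V : lmodType F) (S : set V) (d : nat) :
    Prop :=
  exists b : 'I_d -> V,
    [/\ forall i, S (b i),
        forall c : 'I_d -> F, \sum_i c i *: b i = 0 -> forall i, c i = 0
      & forall v, S v -> exists c : 'I_d -> F, v = \sum_i c i *: b i].

Definition finite_dim (F : numFieldType) (V : lmodType F) (S : set V) : Prop :=
  exists d, has_dim S d.

(* 0 when S is not finite-dimensional *)
Definition dim (F : numFieldType) (V : lmodType F) (S : set V) : nat :=
  xget 0%N [set d | has_dim S d].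

(** * Formal series in x and q with rational exponents

    f r s is the coefficient of x^r q^s. *)

Definition xqseries : Type := rat -> rat -> int.

Definition chi (F : numFieldType) (j : 'I_2) : xqseries :=
  fun r s => (dim (principal_hom (F := F) j r s))%:Z.

(* multiplication by the monomial x^r0 q^s0 *)
Definition xqshift (r0 s0 : rat) (f : xqseries) : xqseries :=
  fun r s => f (r - r0) (s - s0).

(* the power series sum_N a(N) q^N *)
Definition qembed (a : nat -> int) : xqseries :=
  fun r s => if (r == 0) && (s \is a Num.nat) then a (Num.truncn s) else 0.

Definition xqsum (f : nat -> xqseries) : xqseries :=
  fun r s => \sum_(n \in [set: nat]) f n r s.

Definition qpoch (n : nat) : {poly int} := \prod_(1 <= i < n.+1) (1 - 'X^i).

(* The coefficients of the power series 1/p = sum_k (1 - p)^k, for p with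
   constant term 1: only k <= N contributes to the coefficient of q^N. *)
Definition invser (p : {poly int}) (N : nat) : int :=
  (\sum_(k < N.+1) (1 - p) ^+ k)`_N.

Lemma coef_exp_low (u : {poly int}) (k N : nat) :
  u`_0 = 0 -> (N < k)%N -> (u ^+ k)`_N = 0.
Proof.
move=> u0; elim: k N => [//|k IH] N ltNk; rewrite exprS coefM.
apply: big1 => -[[|i] /= lti] _; first by rewrite u0 mul0r.
rewrite IH ?mulr0 //; move: ltNk lti; rewrite !ltnS => leNk lti.
by case: N leNk lti => [|N] // leNk lti; rewrite subSS (leq_ltn_trans (leq_subr _ _)).
Qed.

Lemma invserP (p : {poly int}) (N : nat) : p`_0 = 1 ->
  \sum_(i < N.+1) p`_i * invser p (N - i) = (N == 0%N)%:R.
Proof.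
move=> p0; have u0 : (1 - p)`_0 = 0 by rewrite coefB coef1 p0 subrr.
have -> : (N == 0%N)%:R = (p * \sum_(k < N.+1) (1 - p) ^+ k)`_N :> int.
  rewrite -[X in X * _](subKr 1) -[X in X * _]opprB mulNr -subrX1 opprB.
  by rewrite coefB coef1 coef_exp_low // subr0.
rewrite coefM; apply: eq_bigr => i _; congr (_ * _); rewrite /invser.
have lei : ((N - i).+1 <= N.+1)%N by rewrite ltnS leq_subr.
rewrite (big_ord_widen _ (fun k => (1 - p) ^+ k) lei) !coef_sum.
rewrite big_mkcond /=; apply: eq_bigr => k _; case: ifP => // /negbT.
by rewrite -leqNgt => ltk; rewrite coef_exp_low.
Qed.

Lemma qpoch0 (n : nat) : (qpoch n)`_0 = 1.
Proof.
rewrite /qpoch big_nat; elim/big_ind: _ => [|p q p0 q0|i /andP[i1 _]].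
- by rewrite coef1.
- by rewrite coefM big_ord1 p0 q0 mulr1.
- by rewrite coefB coef1 coefXn; case: i i1 => //= i _; rewrite subr0.
Qed.

(* Main.v *)
Require Import Defs.
From HB Require Import structures.
From mathcomp Require Import all_boot all_order all_algebra finmap.
From mathcomp Require Import monalg complex.
From mathcomp Require Import boolp classical_sets functions cardinality fsbigop reals.
From mathcomp Require Import zify ring.
Set Implicit Arguments.
Unset Strict Implicit.
Unset Printing Implicit Defensive.
Import Order.TTheory GRing.Theory Num.Theory.
Local Open Scope ring_scope.
Local Open Scope classical_set_scope.

(* Reading h(-n) as the n-th power sum identifies M(1) with the ring of
   symmetric functions; then E^-(-alpha, x) is multiplication by the generating
   series of the complete symmetric functions H_p, and E^+(-alpha, x) is an
   exponential of the derivations d/dh(-n), which send H_p to H_(p - n) / n.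
   Hence x_alpha(m) maps the span T_k of the products of k factors H_a, placed
   at charge k + j/2, into T_(k + 1).  Conversely x_alpha(m) f is H_N f plus
   terms H_(N + q) E_q f with q > 0 and E_q f in T_k of lower degree, so by
   induction on k and on the degree all of T_k lies in W(Lambda_j).  The H_mu
   with mu a partition into at most k parts form a basis of T_k, because H_mu
   is a nonzero multiple of the monomial h(-mu_1) h(-mu_2) ... plus longer
   monomials; and 1 / (q)_k counts these partitions. *)

(** * Linear maps given on a basis *)

HB.lock Definition malgext (F : numFieldType) (K : choiceType) (V : lmodType F)
    (g : K -> V) (f : {malg F[K]}) : V :=
  \sum_(k <- msupp f) f@_k *: g k.
Canonical malgext_unlockable := Unlockable malgext.unlock.

Section LinExt.
Context {F : numFieldType}.

Section Def.
Context {K : choiceType} {V : lmodType F}.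
Implicit Types (g : K -> V) (f : {malg F[K]}).

Lemma malgextw g (d : {fset K}) f : {subset msupp f <= d} ->
  malgext g f = \sum_(k <- d) f@_k *: g k.
Proof.
move=> sub; rewrite unlock; apply: big_fset_incl; first exact/fsubsetP.
by move=> k _ kf; rewrite mcoeff_outdom // scale0r.
Qed.

(** The supports of [u], [v] and [a *: u + v] differ, so all three sums are first taken over their
    union. *)
Lemma malgextP g (a : F) u v : malgext g (a *: u + v) = a *: malgext g u + malgext g v.
Proof.
pose d := (msupp u `|` msupp v `|` msupp (a *: u + v))%fset.
have sub w : (msupp w `<=` d)%fset -> {subset msupp w <= d} by move/fsubsetP.
rewrite !(@malgextw g d); [|apply: sub..]; last first.
- by rewrite /d; apply/fsubsetP => x; rewrite !inE => ->; rewrite ?orbT.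
- by rewrite /d; apply/fsubsetP => x; rewrite !inE => ->; rewrite ?orbT.
- by rewrite /d; apply/fsubsetP => x; rewrite !inE => ->; rewrite ?orbT.
rewrite scaler_sumr -big_split /=; apply: eq_bigr => k _.
by rewrite mcoeffD mcoeffZ scalerDl scalerA.
Qed.

HB.instance Definition _ g :=
  GRing.isLinear.Build F {malg F[K]} V _ (malgext g) (malgextP g).

Lemma malgextU g k : malgext g << k >> = g k.
Proof. by rewrite unlock msuppU oner_eq0 big_seq_fset1 mcoeffUU scale1r. Qed.

Lemma malg_linE f : f = \sum_(k <- msupp f) f@_k *: << k >>.
Proof.
rewrite {1}(monalgE f); apply: eq_bigr => k _; apply/malgP => k'.
by rewrite mcoeffZ !mcoeffU mulrnAr mulr1.
Qed.

(** Linearity is a hypothesis on plain functions, so that composites such as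
    [fun f => hder i (f * g)] qualify without a declared linear structure. *)
Lemma eq_malg (h1 h2 : {malg F[K]} -> V) :
    (forall a u v, h1 (a *: u + v) = a *: h1 u + h1 v) ->
    (forall a u v, h2 (a *: u + v) = a *: h2 u + h2 v) ->
  (forall k, h1 << k >> = h2 << k >>) -> h1 =1 h2.
Proof.
move=> l1 l2 eqh f.
pose H1 := GRing.isLinear.Build F {malg F[K]} V _ h1 l1.
pose H2 := GRing.isLinear.Build F {malg F[K]} V _ h2 l2.
pose L1 : {linear {malg F[K]} -> V} := HB.pack h1 H1.
pose L2 : {linear {malg F[K]} -> V} := HB.pack h2 H2.
rewrite -[h1]/(L1 : _ -> _) -[h2]/(L2 : _ -> _) (malg_linE f) !linear_sum /=.
apply: eq_bigr => k _; have := l1 (f@_k) << k >> 0; have := l2 (f@_k) << k >> 0.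
have z1 : h1 0 = 0 := raddf0 L1; have z2 : h2 0 = 0 := raddf0 L2.
by rewrite z1 z2 !addr0 eqh => -> ->.
Qed.

End Def.
End LinExt.

(** * Complete symmetric functions and their derivatives *)

Section Derivation.
Context {F : numFieldType} {A : comAlgType F}.
Variables (h : nat -> A) (der : nat -> {linear A -> A}).
Hypotheses (derM : forall i f g, der i (f * g) = der i f * g + f * der i g)
  (der_gen : forall i k, der i (h k) = (i == k)%:R).

Lemma der_natr i n : der i n%:R = 0.
Proof.
rewrite raddfMn /=; have := derM i 1 1; rewrite !mulr1 mul1r.
by move/(congr1 (fun x => x - der i 1)); rewrite addrK subrr => <-; rewrite mul0rn.
Qed.

Definition tlog (p : nat) : A :=
  if p is i.+1 then (i.+1%:R)^-1 *: h i else 0.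

(* With h i standing for h(-(i+1)), the coefficient of x^p in
   (sum_(n > 0) h(-n) x^n / n)^j. *)
Fixpoint tlogpow (j p : nat) : A :=
  if j is j'.+1 then \sum_(i < p.+1) tlog i * tlogpow j' (p - i)
  else (p == 0)%:R.

(* If h(-n) is read as the n-th power sum, this is the p-th complete
   symmetric function. *)
Definition hsym (p : nat) : A :=
  \sum_(j < p.+1) (j`!%:R)^-1 *: tlogpow j p.

Lemma hsym0 : hsym 0 = 1.
Proof. by rewrite /hsym big_ord1 invr1 scale1r. Qed.

(** Splits off the linear part, later the leading term: j = 0 contributes nothing in positive
    degree, and j = 1 contributes h(-(i+1)) / (i+1). *)
Lemma hsymS i : hsym i.+1 = i.+1%:R^-1 *: h i +
  \sum_(j < i) (j.+2`!%:R)^-1 *: tlogpow j.+2 i.+1.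
Proof.
rewrite /hsym big_ord_recl big_ord_recl [tlogpow _ _]/= scaler0 add0r.
congr (_ + _); rewrite invr1 scale1r [tlogpow _ _]/= big_ord_recr /= subnn mulr1.
by rewrite big1 ?add0r // => u _; rewrite subn_eq0 leqNgt ltn_ord mulr0.
Qed.

(** The series has no constant term, so its j-th power starts at x^j; this justifies the truncation
    in [hsym]. *)
Lemma tlogpow_small j p : (p < j)%N -> tlogpow j p = 0.
Proof.
elim: j p => [//|j IH] p ltpj /=; apply: big1 => -[[|i] /= lti] _.
  by rewrite mul0r.
rewrite IH ?mulr0 //; case: p ltpj lti => [|p] //; rewrite !ltnS subSS => ltpj _.
exact: leq_ltn_trans (leq_subr _ _) ltpj.
Qed.

Lemma der_log i p : der i (tlog p) = (p == i.+1)%:R *: ((i.+1%:R)^-1)%:A.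
Proof.
case: p => [|p]; first by rewrite linear0 scale0r.
rewrite linearZ /= der_gen eqSS eq_sym.
by case: eqP => [->|_]; rewrite ?scale1r // scaler0 scale0r.
Qed.

(** Chain rule for T^(j+1), where T = sum_(n > 0) h(-n) x^n / n: the derivative of T by h(-(i+1)) is
    x^(i+1) / (i+1). *)
Lemma der_logpow i j p : der i (tlogpow j.+1 p) =
  if (i < p)%N then (j.+1%:R / i.+1%:R) *: tlogpow j (p - i.+1) else 0.
Proof.
(* Only u = i + 1 contributes, because [der i] kills every other [tlog u]. *)
have single q (G : nat -> A) :
    \sum_(u < q.+1) der i (tlog u) * G u
    = if (i < q)%N then (i.+1%:R)^-1 *: G i.+1 else 0.
  case: ltnP => ltiq.
    rewrite (bigD1 (inord i.+1 : 'I_q.+1)) //= inordK // big1 ?addr0.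
      by rewrite der_log eqxx scale1r -scalerAl mul1r.
    move=> u neu; rewrite der_log; case: eqP => [eu|_]; last by rewrite scale0r mul0r.
    by case/negP: neu; rewrite -eu inord_val.
  apply: big1 => u _; rewrite der_log; case: eqP => [eu|_]; last by rewrite scale0r mul0r.
  by move: (ltn_ord u); rewrite eu ltnS ltnNge ltiq.
elim: j p => [|j IH] p.
  rewrite [tlogpow _ _]/= linear_sum /=.
  under eq_bigr => u _ do rewrite derM.
  rewrite big_split /= (single _ (fun u => (p - u == 0)%N%:R)) [X in _ + X]big1.
    by rewrite addr0; case: ifP; rewrite // mul1r.
  by move=> u _; rewrite der_natr mulr0.
rewrite [tlogpow _ _]/= -/(tlogpow j.+1 _) linear_sum /=.
under eq_bigr => u _ do rewrite derM.
rewrite big_split /= (single _ (fun u => tlogpow j.+1 (p - u))).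
under [X in _ + X]eq_bigr => u _ do rewrite -/(tlogpow j.+1 _) IH.
case: ltnP => ltip; last first.
  rewrite add0r big1 // => u _; rewrite ifN ?mulr0 // -leqNgt.
  exact: leq_trans (leq_subr _ _) ltip.
have -> : \sum_(u < p.+1) tlog u * (if (i < p - u)%N then
      (j.+1%:R / i.+1%:R) *: tlogpow j (p - u - i.+1) else 0)
   = (j.+1%:R / i.+1%:R) *: tlogpow j.+1 (p - i.+1).
  rewrite [tlogpow j.+1 _]/= scaler_sumr.
  rewrite (big_ord_widen p.+1 (fun u => _ *: (tlog u * tlogpow j (p - i.+1 - u))));
    last by rewrite ltnS leq_subr.
  rewrite [RHS]big_mkcond /=; apply: eq_bigr => u _.
  have -> : (i < p - u)%N = (u < (p - i.+1).+1)%N.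
    by rewrite ltn_subRL [RHS]ltnS leq_subRL // addSn (addnC i).
  by case: ifP => _; rewrite ?mulr0 // scalerAr subnAC.
by rewrite -scalerDl -[j.+2]add1n natrD mulrDl mul1r.
Qed.

(** Chain rule for exp T: since (j+1) / (j+1)! = 1 / j!, the derivative of the term j + 1 is the
    term j times x^(i+1) / (i+1). *)
Lemma der_sym i p : der i (hsym p) =
  if (i < p)%N then (i.+1%:R)^-1 *: hsym (p - i.+1) else 0.
Proof.
rewrite /hsym linear_sum big_ord_recl /= linearZ /=.
rewrite der_natr scaler0 add0r.
under eq_bigr => j _ do rewrite linearZ /= -/(tlogpow j.+1 p) der_logpow.
case: ltnP => ltip; last by rewrite big1 // => j _; rewrite scaler0.
rewrite scaler_sumr (big_ord_widen p
  (fun j => _ *: ((j`!%:R)^-1 *: tlogpow j (p - i.+1)))); last first.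
  by rewrite subnSK // leq_subr.
rewrite [RHS]big_mkcond /=; apply: eq_bigr => j _.
rewrite !scalerA /bump /= add1n; case: ltnP => [_|ltj].
  congr (_ *: _); rewrite factS natrM invfM.
  have j1 : j.+1%:R != 0 :> F by rewrite pnatr_eq0.
  by rewrite mulrACA mulVf // mul1r mulrC.
(* These powers exceed the remaining degree p - i - 1. *)
by rewrite tlogpow_small ?scaler0.
Qed.

End Derivation.

(** * The partial derivatives on M(1) *)

Section Fock.
Context {F : numFieldType}.
Local Notation M := {malg F[{cmonom nat}]}.
Implicit Types (f g : M) (m : {cmonom nat}).

(* h(-(i+1)) *)
Definition hgen (i : nat) : M := << ucm i >>.

(** The plain derivative by h(-(i+1)); the factor 2(i+1) of the Heisenberg operator appears only in
    [heis_pos]. *)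
Definition hder (i : nat) : M -> M :=
  malgext (fun m => (m i)%:R *: << divcm m (ucm i) >>).

HB.instance Definition _ i := GRing.Linear.on (hder i).

Lemma malgMUU m m' : << m >> * << m' >> = << mulcm m m' >> :> M.
Proof. by rewrite malgM_def fgmulUU mulr1. Qed.

Lemma hderP i a f g : hder i (a *: f + g) = a *: hder i f + hder i g.
Proof. exact: malgextP. Qed.

Lemma hderU i m : hder i << m >> = (m i)%:R *: << divcm m (ucm i) >>.
Proof. exact: malgextU. Qed.

Lemma mulr_linl (A : comAlgType F) (a : F) (x1 x2 y1 y2 z w : A) :
  (a *: x1 + x2) * z + (a *: y1 + y2) * w =
  a *: (x1 * z + y1 * w) + (x2 * z + y2 * w).
Proof. by rewrite !mulrDl -!scalerAl scalerDr addrACA. Qed.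

Lemma mulr_linr (A : comAlgType F) (a : F) (x1 x2 y1 y2 z w : A) :
  z * (a *: x1 + x2) + w * (a *: y1 + y2) =
  a *: (z * x1 + w * y1) + (z * x2 + w * y2).
Proof. by rewrite !mulrDr -!scalerAr scalerDr addrACA. Qed.

Lemma hderM i f g : hder i (f * g) = hder i f * g + f * hder i g.
Proof.
apply: (@eq_malg _ _ _ (fun f => hder i (f * g))
  (fun f => hder i f * g + f * hder i g)) => [a u v|a u v|m].
- by rewrite mulrDl -(scalerAl a) hderP.
- rewrite hderP; exact: mulr_linl.
apply: (@eq_malg _ _ _ (fun g => hder i (<< m >> * g))
  (fun g => hder i << m >> * g + << m >> * hder i g)) => [a u v|a u v|m'].
- by rewrite mulrDr -(scalerAr a) hderP.
- rewrite hderP; exact: mulr_linr.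
have scl a x y : (a *: << x >>) * << y >> = a *: << mulcm x y >> :> M.
  by rewrite -malgMUU; exact/esym/scalerAl.
have scr a x y : << x >> * (a *: << y >>) = a *: << mulcm x y >> :> M.
  by rewrite -malgMUU; exact/esym/scalerAr.
transitivity (hder i << mulcm m m' >>); first by congr (hder i _); exact: malgMUU.
transitivity ((m i)%:R *: << mulcm (divcm m (ucm i)) m' >> +
    (m' i)%:R *: << mulcm m (divcm m' (ucm i)) >> : M); last first.
  by congr (_ + _); [rewrite -scl | rewrite -scr]; rewrite -hderU.
rewrite hderU mulcmE natrD scalerDl.
(* If h(-(i+1)) does not occur in [m1], the quotients may be junk but the scalars vanish; otherwise
   division commutes with the product. *)
have divM m1 m2 : (m1 i)%:R *: << divcm (mulcm m1 m2) (ucm i) >> =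
    (m1 i)%:R *: << mulcm (divcm m1 (ucm i)) m2 >> :> M.
  have [->|m1i] := eqVneq (m1 i) 0%N; first exact: etrans (scale0r _) (esym (scale0r _)).
  congr (_ *: << _ >>); apply/eqP/cmP => l; rewrite !(divcmE, mulcmE) ucmE.
  by case: eqP => [<-|_]; rewrite ?subn0 // addnC -addnBA ?lt0n // addnC.
apply: (f_equal2 (fun x y : M => x + y)); first exact: divM.
by rewrite (mulcmC m m') (mulcmC m); exact: divM.
Qed.

Lemma hder_gen i k : hder i (hgen k) = (i == k)%:R.
Proof.
rewrite /hgen hderU ucmE eq_sym; case: eqP => [->|_]; last by rewrite scale0r.
rewrite scale1r; congr << _ >>; apply/eqP/cmP => l.
by rewrite divcmE subnn onecmE.
Qed.

End Fock.

(** * Linear spans *)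

Section Span.
Context {F : numFieldType} {V : lmodType F}.
Implicit Types (S P : set V).

Definition lclosed P := P 0 /\ forall a u v, P u -> P v -> P (a *: u + v).

(** The intersection of all linearly closed sets containing [S]: membership is used by induction,
    without writing out linear combinations. *)
Definition lspan S : set V := [set v | forall P, lclosed P -> S `<=` P -> P v].

Lemma lspan_closed S : lclosed (lspan S).
Proof.
split=> [P [P0 _] _ //|a u v Su Sv P cP sP].
by case: (cP) => _; apply; [exact: Su | exact: Sv].
Qed.

Lemma sub_lspan S : S `<=` lspan S.
Proof. by move=> v Sv P _; apply. Qed.

Lemma lspan_ind S P : lclosed P -> S `<=` P -> lspan S `<=` P.
Proof. by move=> cP sP v; apply. Qed.

Lemma lspan0 v : lspan set0 v -> v = 0.
Proof.
apply: (@lspan_ind _ (fun w => w = 0)) => //.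
by split=> // a u w -> ->; rewrite scaler0 addr0.
Qed.

Section Closed.
Context {P : set V} (cP : lclosed P).

Lemma lclosed0 : P 0. Proof. by case: cP. Qed.

Lemma lclosedZ a v : P v -> P (a *: v).
Proof. by case: cP => P0 PP Pv; rewrite -[_ *: _]addr0; apply: PP. Qed.

Lemma lclosedD u v : P u -> P v -> P (u + v).
Proof. by case: cP => P0 PP Pu Pv; rewrite -[u]scale1r; apply: PP. Qed.

Lemma lclosed_sum (I : Type) (r : seq I) (Q : pred I) (G : I -> V) :
  (forall i, Q i -> P (G i)) -> P (\sum_(i <- r | Q i) G i).
Proof.
move=> PG; elim/big_ind: _ => //; [exact: lclosed0 | exact: lclosedD].
Qed.

End Closed.
End Span.

Lemma lspan_image (F : numFieldType) (V W : lmodType F) (S : set V) (P : set W)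
    (L : V -> W) :
    (forall a u v, L (a *: u + v) = a *: L u + L v) -> lclosed P ->
  (forall v, S v -> P (L v)) -> forall v, lspan S v -> P (L v).
Proof.
move=> linL [P0 PP] SP; apply: lspan_ind => //; split=> [|a u v Pu Pv].
  have := linL (-1) 0 0; rewrite scaler0 addr0 scaleN1r addNr => L0.
  by rewrite /= L0.
by rewrite /= linL; apply: PP.
Qed.

(** * Spans of products of k complete symmetric functions *)

Section HSpan.
Context {F : numFieldType} {A : comAlgType F}.
Variables (h : nat -> A) (der : nat -> {linear A -> A}).
Hypotheses (derM : forall i f g, der i (f * g) = der i f * g + f * der i g)
  (der_gen : forall i k, der i (h k) = (i == k)%:R).

Definition hprod (t : seq nat) : A := \prod_(a <- t) hsym h a.

(* The degree d is an integer so that lowering it never truncates; the span is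
   zero for d < 0. *)
Definition hspan (k : nat) (d : int) : set A :=
  lspan [set f | exists t, [/\ size t = k, (sumn t)%:Z = d & f = hprod t]].

Lemma hspan_prod t : hspan (size t) (sumn t)%:Z (hprod t).
Proof. by apply: sub_lspan; exists t. Qed.

(** No list of naturals has a negative sum, so there are no generators. This is what makes E^+
    locally finite. *)
Lemma hspan_neg k d f : d < 0 -> hspan k d f -> f = 0.
Proof.
move=> d0; have -> : hspan k d = lspan set0; last exact: lspan0.
congr lspan; apply/seteqP; split=> // g [t [_ dt _]].
by move: d0; rewrite -dt.
Qed.

Lemma hspanM k d a f : hspan k d f -> hspan k.+1 (a%:Z + d) (hsym h a * f).
Proof.
move: f; apply: lspan_image; [|exact: lspan_closed|].
  by move=> b u v; rewrite mulrDr scalerAr.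
move=> _ [t [st dt ->]]; apply: sub_lspan; exists (a :: t); split.
- by rewrite /= st.
- by rewrite /= PoszD dt.
- by rewrite /hprod big_cons.
Qed.

(** By the Leibniz rule each term turns one factor H_a into a multiple of H_(a-i-1), or into 0 if a
    is too small. The number of factors stays k because H_0 = 1 counts as a factor. *)
Lemma hspan_der k d i f : hspan k d f -> hspan k (d - i.+1%:Z) (der i f).
Proof.
move: f; apply: lspan_image; [by move=> b u v; rewrite linearP|exact: lspan_closed|].
move=> _ [t [<- <- ->]] {k d}; elim: t => [|a t IH].
  rewrite /hprod big_nil (der_natr derM _ 1); exact: (lclosed0 (lspan_closed _)).
rewrite /hprod big_cons derM; apply: (lclosedD (lspan_closed _)).
  rewrite (der_sym derM der_gen); case: ltnP => ltia; last first.
    rewrite mul0r; exact: (lclosed0 (lspan_closed _)).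
  rewrite -scalerAl; apply: (lclosedZ (lspan_closed _)); apply: sub_lspan.
  exists ((a - i.+1)%N :: t); split=> //=; last by rewrite /hprod big_cons.
  by rewrite !PoszD addrAC -subzn.
by rewrite PoszD -addrA; apply: hspanM.
Qed.

End HSpan.

Lemma scaler_linr (F : numFieldType) (V : lmodType F) (b a : F) (u v : V) :
  b *: (a *: u + v) = a *: (b *: u) + b *: v.
Proof. by rewrite scalerDr !scalerA mulrC. Qed.

Lemma scaler_lin0 (F : numFieldType) (V : lmodType F) (a : F) :
  0 = a *: 0 + 0 :> V.
Proof. by rewrite scaler0 addr0. Qed.

(** * The factors of the vertex operator on vectors of one charge *)

Section FockSpace.
Context {F : numFieldType}.
Local Notation M := {malg F[{cmonom nat}]}.
Local Notation V := (VP F).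
Implicit Types (f g : M) (u v w : V) (A B : opser F).

Lemma linextE (phi : {cmonom nat} -> int -> V) :
  linext phi = malgext (fun b => phi b.1 b.2).
Proof. by rewrite unlock. Qed.

Lemma linextP (phi : {cmonom nat} -> int -> V) a u v :
  linext phi (a *: u + v) = a *: linext phi u + linext phi v.
Proof. by rewrite linextE malgextP. Qed.

Definition incharge (c : int) : M -> V := malgext (fun m => basisv F m c).

Lemma inchargeP c a f g :
  incharge c (a *: f + g) = a *: incharge c f + incharge c g.
Proof. exact: malgextP. Qed.

Lemma incharge0 c : incharge c 0 = 0.
Proof. exact: raddf0. Qed.

Lemma inchargeZ c a f : incharge c (a *: f) = a *: incharge c f.
Proof. by rewrite -[_ *: f]addr0 inchargeP incharge0 addr0. Qed.

Lemma incharge_sum c (I : Type) (r : seq I) (Q : pred I) (G : I -> M) :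
  incharge c (\sum_(i <- r | Q i) G i) = \sum_(i <- r | Q i) incharge c (G i).
Proof. exact: raddf_sum. Qed.

Lemma inchargeU c m : incharge c << m >> = basisv F m c.
Proof. exact: malgextU. Qed.

Lemma linext_incharge (phi : {cmonom nat} -> int -> V) (psi : M -> V) c :
    (forall a f g, psi (a *: f + g) = a *: psi f + psi g) ->
    (forall m, phi m c = psi << m >>) ->
  forall f, linext phi (incharge c f) = psi f.
Proof.
move=> lpsi e; apply: (@eq_malg _ _ _ (fun f => linext phi (incharge c f))) => //.
  by move=> a f g; rewrite inchargeP linextP.
by move=> m; rewrite inchargeU linextE malgextU e.
Qed.

Lemma heis_neg c i f : heis (Negz i) (incharge c f) = incharge c (hgen i * f).
Proof.
apply: (@linext_incharge _ (fun f => incharge c (hgen i * f))).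
  by move=> a f1 f2; rewrite mulrDr -(scalerAr a) inchargeP.
by move=> m; rewrite /hgen malgMUU inchargeU.
Qed.

Lemma heis_pos c i f : heis i.+1%:Z (incharge c f) =
  (2 * i.+1)%:R *: incharge c (hder i f).
Proof.
apply: (@linext_incharge _ (fun f => _ *: incharge c (hder i f))).
  by move=> a f1 f2; rewrite hderP inchargeP; exact: scaler_linr.
by move=> m; rewrite hderU inchargeZ inchargeU scalerA -natrM.
Qed.

Lemma eop_incharge l c f : eop l (incharge c f) = incharge (l + c) f.
Proof.
apply: (@linext_incharge _ (incharge (l + c))); first exact: inchargeP.
by move=> m; rewrite inchargeU.
Qed.

Lemma xop_incharge l d c f :
  xop l d (incharge c f) = if Defs.form l c == d then incharge c f else 0.
Proof.
apply: (@linext_incharge _ (fun f => if Defs.form l c == d then incharge c f else 0)).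
  move=> a f1 f2; case: (_ == _); [exact: inchargeP | exact: scaler_lin0].
by move=> m; rewrite inchargeU.
Qed.

Definition opslinear A := forall p a u v, A p (a *: u + v) = a *: A p u + A p v.

Lemma opslinear_exp A : opslinear A -> opslinear (opexp A).
Proof.
move=> linA.
have linpow j : opslinear (iter j (opmul A) (@opone F)).
  elim: j => [|j IH] p a u v /=; rewrite /opone ?/opmul.
    by case: (p == 0%N) => //; exact: scaler_lin0.
  rewrite scaler_sumr -big_split /=; apply: eq_bigr => i _.
  by rewrite IH linA.
move=> p a u v; rewrite /opexp scaler_sumr -big_split /=.
apply: eq_bigr => j _; rewrite linpow; exact: scaler_linr.
Qed.

Lemma lamopP l n a u v : lamop l n (a *: u + v) = a *: lamop l n u + lamop l n v.
Proof. by rewrite /lamop /heis linextP; exact: scaler_linr. Qed.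

Lemma opslinear_Eminus l : opslinear (@Eminus F l).
Proof.
apply: opslinear_exp => p a u v; case: (p == 0%N); first exact: scaler_lin0.
rewrite lamopP; exact: scaler_linr.
Qed.

Lemma opslinear_Eplus l : opslinear (@Eplus F l).
Proof.
apply: opslinear_exp => p a u v; case: (p == 0%N); first exact: scaler_lin0.
rewrite lamopP; exact: scaler_linr.
Qed.

(** For lambda = -alpha the factor l/2 = -1 of [lamop] cancels the sign of 1/n at n = -p, so the
    exponent is multiplication by sum_(p > 0) h(-p) x^p / p. *)
Lemma Eminus_incharge c p f :
  Eminus (- 2) p (incharge c f) = incharge c (hsym hgen p * f).
Proof.
set A := fun p v => if p == 0%N then 0 else ((- p%:Z)%:~R)^-1 *: lamop (- 2) (- p%:Z) v.
have mulA q g : A q (incharge c g) = incharge c (tlog hgen q * g).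
  rewrite /A; case: q => [|i] /=; first by rewrite mul0r incharge0.
  have -> : (i.+1%:R^-1 *: hgen i) * g = i.+1%:R^-1 *: (hgen i * g).
    exact/esym/scalerAl.
  rewrite inchargeZ -heis_neg.
  have -> : i.+1%:R^-1 = ((- i.+1%:Z)%:~R)^-1 * ((- 2)%:~R / 2) :> F.
    by rewrite !mulrNz mulNr divff ?pnatr_eq0 // invrN mulrN1 opprK.
  by rewrite -scalerA.
have powA j q g : iter j (opmul A) (@opone F) q (incharge c g) =
    incharge c (tlogpow hgen j q * g).
  elim: j q g => [|j IH] q g; rewrite /= ?/opone ?/opmul.
    by case: eqP; rewrite ?mul1r ?mul0r ?incharge0.
  rewrite mulr_suml incharge_sum; apply: eq_bigr => i _.
  by rewrite IH mulA mulrA.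
rewrite /Eminus -/A /opexp /hsym mulr_suml incharge_sum.
by apply: eq_bigr => j _; rewrite powA -inchargeZ scalerAl.
Qed.

(** The charge [c] and the number [k] of factors are independent, because within one vertex operator
    e^alpha raises the charge before E^- adds a factor. *)
Definition chargespan (c : int) (k : nat) (d : int) : set V :=
  [set v | exists2 f, hspan hgen k d f & v = incharge c f].

Lemma chargespan_closed c k d : lclosed (chargespan c k d).
Proof.
split; first by exists 0; [exact: (lclosed0 (lspan_closed _)) | rewrite incharge0].
move=> a _ _ [f Sf ->] [g Sg ->]; exists (a *: f + g); last by rewrite inchargeP.
by case: (lspan_closed [set f | exists t, [/\ size t = k, (sumn t)%:Z = d
  & f = hprod (@hgen F) t]]) => _; apply.
Qed.

Lemma chargespan_neg c k d v : d < 0 -> chargespan c k d v -> v = 0.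
Proof. by move=> d0 [f Sf ->]; rewrite (hspan_neg d0 Sf) incharge0. Qed.

(** In the exponent, the coefficient of x^-p is a multiple of the derivative by h(-p), which lowers
    the degree by p and keeps k; in powers of the exponent these shifts add up. *)
Lemma chargespan_Eplus c k d q v :
  chargespan c k d v -> chargespan c k (d - q%:Z) (Eplus (- 2) q v).
Proof.
set A := fun p v => if p == 0%N then 0 else (p%:R)^-1 *: lamop (- 2) p%:Z v : V.
have lowA p e u : chargespan c k e u -> chargespan c k (e - p%:Z) (A p u).
  rewrite /A; case: p => [|i] [f Sf ->] /=.
    exact: (lclosed0 (chargespan_closed _ _ _)).
  do 2?apply: (lclosedZ (chargespan_closed _ _ _)).
  rewrite heis_pos; apply: (lclosedZ (chargespan_closed _ _ _)).
  exists (hder i f) => //.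
  exact: (hspan_der (der := @hder F) (@hderM F) (@hder_gen F)).
have lowpow j p e u : chargespan c k e u ->
    chargespan c k (e - p%:Z) (iter j (opmul A) (@opone F) p u).
  elim: j p e u => [|j IH] p e u Su /=; rewrite /opone ?/opmul.
    case: eqP => [->|_]; first by rewrite subr0.
    exact: (lclosed0 (chargespan_closed _ _ _)).
  apply: (lclosed_sum (chargespan_closed _ _ _)) => i _.
  have -> : e - p%:Z = e - (p - i)%N%:Z - i%:Z.
    by rewrite -addrA -opprD -PoszD subnK // -ltnS.
  by apply/lowA/IH.
move=> Sv; rewrite /Eplus -/A /opexp; apply: (lclosed_sum (chargespan_closed _ _ _)).
by move=> j _; apply: (lclosedZ (chargespan_closed _ _ _)); apply: lowpow.
Qed.

Lemma Eplus0 l v : Eplus l 0 v = v.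
Proof. by rewrite /Eplus /opexp big_ord1 /= invr1 scale1r. Qed.

Lemma chargespan_Eminus c k d p v :
  chargespan c k d v -> chargespan c k.+1 (p%:Z + d) (Eminus (- 2) p v).
Proof.
move=> [f Sf ->]; rewrite Eminus_incharge; exists (hsym hgen p * f) => //.
exact: hspanM.
Qed.

Lemma chargespan_eop l c k d v :
  chargespan c k d v -> chargespan (l + c) k d (eop l v).
Proof. by move=> [f Sf ->]; exists f; rewrite ?eop_incharge. Qed.

End FockSpace.

Lemma lincombP (F : numFieldType) (W : lmodType F) (I : Type) (g : I -> W) a
    (s t : seq (F * I)) :
  a *: (\sum_(x <- s) x.1 *: g x.2) + \sum_(x <- t) x.1 *: g x.2 =
  \sum_(x <- [seq (a * x.1, x.2) | x <- s] ++ t) x.1 *: g x.2.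
Proof.
rewrite big_cat big_map scaler_sumr; congr (_ + _).
by apply: eq_bigr => x _; rewrite scalerA.
Qed.

Lemma sub_lin (F : numFieldType) (W : lmodType F) (x y z : W) :
  x = y + z -> y = -1 *: z + x.
Proof. by move=> ->; rewrite scaleN1r addrC addrK. Qed.

(** * Principal subspaces as spans of products of the H_a *)

Section Principal.
Context {F : numFieldType}.
Local Notation V := (VP F).
Implicit Types (u v w : V).

Lemma opslinear0 (A : opser F) p : opslinear A -> A p 0 = 0.
Proof.
move=> linA; have := linA p (-1) 0 0.
by rewrite scaler0 addr0 scaleN1r addNr.
Qed.

Lemma Eplus0r l p : Eplus l p 0 = 0 :> V.
Proof. exact/opslinear0/opslinear_Eplus. Qed.

Lemma Eminus0r l p : Eminus l p 0 = 0 :> V.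
Proof. exact/opslinear0/opslinear_Eminus. Qed.

Lemma eop0 l : eop l 0 = 0 :> V.
Proof. by rewrite -(incharge0 0) eop_incharge !incharge0. Qed.

Definition Yterm (m : int) (pq : nat * nat) (v : V) : V :=
  Eminus (- 2) pq.1 (Eplus (- 2) pq.2
    (eop 2 (xop 2 (- m%:~R - 1 - pq.1%:R + pq.2%:R) v))).

Lemma xalphaE m v : xalpha m v = \sum_(pq \in [set: nat * nat]) Yterm m pq v.
Proof. by []. Qed.

Lemma YtermP m pq a u v : Yterm m pq (a *: u + v) =
  a *: Yterm m pq u + Yterm m pq v.
Proof. by rewrite /Yterm /eop /xop !linextP opslinear_Eplus opslinear_Eminus. Qed.

(** On e^(c alpha/2) the operator x^alpha is x^c, so the coefficient of x^(-m-1) involves only pairs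
    with p - q + c = -m - 1. *)
Lemma Yterm_chargespan m pq c k d v : chargespan c k d v -> Yterm m pq v =
  if pq.1%:Z == pq.2%:Z - m - 1 - c then
    Eminus (- 2) pq.1 (Eplus (- 2) pq.2 (eop 2 v)) else 0.
Proof.
case=> f Sf ->; rewrite /Yterm xop_incharge.
have -> : (Defs.form 2 c == - m%:~R - 1 - pq.1%:R + pq.2%:R) =
    (pq.1%:Z == pq.2%:Z - m - 1 - c).
  rewrite /Defs.form mulrAC divff // mul1r.
  rewrite -(eqr_int rat) !(rmorphB, rmorphD, rmorphN) /= -subr_eq0 -[RHS]subr_eq0.
  by congr (_ == 0); rewrite -!pmulrn; ring.
by case: (_ == _); rewrite // eop0 Eplus0r Eminus0r.
Qed.

(** A sum with infinitely many nonzero terms takes the default value 0, so linearity of [xalpha m]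
    is proved for vectors with such a bound. *)
Definition locfin m v := exists b : nat, forall pq,
  (b <= pq.1)%N || (b <= pq.2)%N -> Yterm m pq v = 0.

Lemma xalpha_finite m v b :
    (forall pq, (b <= pq.1)%N || (b <= pq.2)%N -> Yterm m pq v = 0) ->
  xalpha m v = \sum_(pq <- [seq (p, q) | p <- iota 0 b, q <- iota 0 b]) Yterm m pq v.
Proof.
move=> Y0; rewrite xalphaE (fsbigE [seq (p, q) | p <- iota 0 b, q <- iota 0 b]) //.
- by rewrite big_mkcond; apply: eq_bigr => pq _; rewrite in_setT.
- by apply: allpairs_uniq => [||[? ?] [? ?] _ _ //]; exact: iota_uniq.
move=> [p q] _ nin; apply: Y0 => /=.
have [//|ltp] := leqP b p; have [//|ltq] := leqP b q.
by case/allpairsP: nin; exists (p, q); rewrite !mem_iota /= ltp ltq.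
Qed.

Lemma locfin_chargespan m c k d v : chargespan c k d v -> locfin m v.
Proof.
(* If q > d, then E^+ makes the degree negative and the term vanishes; if q <= d, then both q and p
   = q - m - 1 - c are below this bound. *)
move=> Sv; exists (absz d + absz (m + 1 + c)%R + 1)%N => -[p q] /= big.
rewrite (Yterm_chargespan _ _ Sv) /=.
case: eqP => // ep; have [qd|dq] := leP q%:Z d.
  by exfalso; move: big qd ep; lia.
have -> : Eplus (- 2) q (eop 2 v) = 0 :> V.
  by apply: (chargespan_neg _ (chargespan_Eplus q (chargespan_eop 2 Sv))); lia.
exact: Eminus0r.
Qed.

Lemma locfin_xalphaP m a u v : locfin m u -> locfin m v ->
  xalpha m (a *: u + v) = a *: xalpha m u + xalpha m v.
Proof.
move=> [bu fu] [bv fv]; pose b := maxn bu bv.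
have {}fu pq : (b <= pq.1)%N || (b <= pq.2)%N -> Yterm m pq u = 0.
  by move=> h; apply: fu; move: h; rewrite /b; lia.
have {}fv pq : (b <= pq.1)%N || (b <= pq.2)%N -> Yterm m pq v = 0.
  by move=> h; apply: fv; move: h; rewrite /b; lia.
rewrite (xalpha_finite fu) (xalpha_finite fv) (@xalpha_finite _ _ b).
  rewrite scaler_sumr -big_split /=; apply: eq_bigr => pq _; exact: YtermP.
move=> pq h; rewrite YtermP fu // fv //; exact/esym/scaler_lin0.
Qed.

Lemma locfin_closed m : lclosed (locfin m).
Proof.
split=> [|a u v [bu fu] [bv fv]].
  exact: (locfin_chargespan _ (lclosed0 (chargespan_closed 0 0 0))).
exists (maxn bu bv) => pq h; rewrite YtermP fu ?fv; first exact/esym/scaler_lin0.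
  by move: h; lia.
by move: h; lia.
Qed.

(** E^- supplies the additional factor. The degree changes by p - q, which the charge fixes to -m -
    1 - c. *)
Lemma chargespan_xalpha m c k d v : chargespan c k d v ->
  chargespan (2 + c) k.+1 (d - m - 1 - c) (xalpha m v).
Proof.
move=> Sv; rewrite xalphaE.
apply: (lclosed_sum (chargespan_closed _ _ _)) => -[p q] _.
rewrite (Yterm_chargespan _ _ Sv) /=; case: eqP => [ep|_]; last first.
  exact: (lclosed0 (chargespan_closed _ _ _)).
have -> : d - m - 1 - c = p%:Z + (d - q%:Z) by rewrite ep; ring.
exact/chargespan_Eminus/chargespan_Eplus/chargespan_eop.
Qed.

Definition word (j : 'I_2) (s : seq int) : V :=
  foldr (@xalpha F) (vLambda F j) s.

Lemma word_chargespan (j : 'I_2) (s : seq int) : exists d,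
  chargespan (2 * size s + j)%N%:Z (size s) d (word j s).
Proof.
elim: s => [|m s [d IH]].
  exists 0; exists 1; last exact: (esym (inchargeU j%:Z (onecm nat))).
  by have := @hspan_prod F {malg F[{cmonom nat}]} hgen [::]; rewrite /hprod big_nil.
exists (d - m - 1 - (2 * size s + j)%N%:Z).
have -> : (2 * size (m :: s) + j)%N%:Z = 2 + (2 * size s + j)%N%:Z by rewrite /=; lia.
exact: chargespan_xalpha.
Qed.

Lemma principalE j : principal j = lspan (range (word j)).
Proof.
apply/seteqP; split=> [_ [s ->] | v].
  apply: (lclosed_sum (lspan_closed _)) => t _.
  apply: (lclosedZ (lspan_closed _)); apply: sub_lspan; by exists t.2.
apply: lspan_ind => [|_ [s _ <-]].
  split=> [|a _ _ [s ->] [t ->]]; first by exists [::]; rewrite big_nil.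
  exists ([seq (a * x.1, x.2) | x <- s] ++ t).
  exact: lincombP.
by exists [:: (1, s)]; rewrite big_seq1 scale1r.
Qed.

Lemma principal_closed j : lclosed (principal (F := F) j).
Proof. rewrite principalE; exact: lspan_closed. Qed.

Lemma principal_xalpha j m v : principal j v -> principal j (xalpha m v).
Proof.
rewrite principalE => Sv.
(* Local finiteness is carried through the induction, since the linearity of [xalpha m] relies on
   it. *)
have : (locfin m `&` [set v | lspan (range (word j)) (xalpha m v)]) v.
  apply: lspan_ind Sv => [|_ [s _ <-]].
    have l0 := lclosed0 (locfin_closed m).
    split=> [|a u w [lu Pu] [lw Pw]]; split=> /=.
    - exact: l0.
    - have := locfin_xalphaP (-1) l0 l0.
      rewrite scaler0 addr0 scaleN1r addNr => ->; exact: (lclosed0 (lspan_closed _)).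
    - by case: (locfin_closed m) => _; apply.
    - rewrite (locfin_xalphaP _ lu lw).
      exact: (lclosedD (lspan_closed _) (lclosedZ (lspan_closed _) a Pu) Pw).
  split; first by have [d] := word_chargespan j s; exact: locfin_chargespan.
  by apply: sub_lspan; exists (m :: s).
by case.
Qed.

(** The mode is chosen so that p = N + q on this charge; the term q = 0 is then H_N times e^alpha v.
    The sum stops at |d|, since E^+ gives 0 beyond the degree. *)
Lemma xalpha_top c k d v N : chargespan c k d v ->
  exists b, xalpha (- c - 1 - N%:Z) v = \sum_(q < b.+1)
    Eminus (- 2) (N + q) (Eplus (- 2) q (eop 2 v)).
Proof.
move=> Sv; exists `|d|%N; rewrite xalphaE.
rewrite (fsbigE [seq ((N + q)%N, q) | q <- iota 0 `|d|.+1]) //.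
- rewrite big_map -[X in iota _ X]subn0 -/(index_iota 0 _) big_mkord.
  apply: eq_big => [q|q _]; first by rewrite in_setT.
  rewrite (Yterm_chargespan _ _ Sv) /= ifT //.
  by apply/eqP; rewrite PoszD; ring.
- by rewrite map_inj_uniq ?iota_uniq // => x y [].
move=> [p q] _ nin; rewrite (Yterm_chargespan _ _ Sv) /=; case: eqP => // ep.
have [ltq|leq] := ltnP q `|d|.+1.
  case/negP: nin; apply/mapP; exists q; first by rewrite mem_iota.
  by congr (_, _); lia.
have -> : Eplus (- 2) q (eop 2 v) = 0 :> V.
  by apply: (chargespan_neg _ (chargespan_Eplus q (chargespan_eop 2 Sv))); lia.
exact: Eminus0r.
Qed.

(* The term q = 0 of x_alpha(m) v is H_N * v, and the other
   terms multiply vectors of lower degree. *)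
Lemma chargespan_principal (j : 'I_2) k d v :
  chargespan (2 * k + j)%N%:Z k d v -> principal j v.
Proof.
elim: k d v => [|k IH] d _ [f Sf ->].
  move: f Sf; apply: lspan_image; [exact: inchargeP | exact: principal_closed |].
  move=> _ [t [/size0nil -> _ ->]]; rewrite /hprod big_nil principalE.
  apply: sub_lspan.
  exact: (ex_intro2 _ _ [::] I (esym (inchargeU j%:Z (onecm nat)))).
set c : int := (2 * k.+1 + j)%N%:Z in Sf *.
(* Inner induction, on a strict bound [n] for the degree [e]; at n = 0 the degree is negative and
   [v] is 0. *)
have top n e v N : chargespan c k e v -> e < n%:Z -> principal j (Eminus (- 2) N v).
  elim: n e v N => [|n IHn] e v N Sv ltn.
    rewrite (chargespan_neg ltn Sv) Eminus0r; exact: (lclosed0 (principal_closed _)).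
  (* Stripping e^alpha off [v] gives a vector with k factors at the matching charge, to which the
     outer induction applies. *)
  pose v' := eop (- 2) v.
  have vE : eop 2 v' = v.
    by rewrite /v'; case: Sv => g Sg ->; rewrite !eop_incharge addNKr.
  have Sv' : chargespan (2 * k + j)%N%:Z k e v'.
    have -> : (2 * k + j)%N%:Z = - 2 + c by rewrite /c; lia.
    exact: chargespan_eop.
  have [b] := xalpha_top N Sv'; rewrite vE big_ord_recl.
  set rest := \sum_(i < b) _ => xE.
  have -> : Eminus (- 2) N v = -1 *: rest + xalpha (- (2 * k + j)%N%:Z - 1 - N%:Z) v'.
    apply: sub_lin (etrans xE _); congr (_ + _).
    exact: (f_equal2 (fun p w => Eminus (- 2) p w) (addn0 N) (Eplus0 _ _)).
  case: (principal_closed j) => _; apply; last exact/principal_xalpha/(IH e).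
  apply: (lclosed_sum (principal_closed _)) => i _.
  (* The index i stands for q = i + 1, so E^+ lowers the degree by at least 1. *)
  apply: (IHn (e - (bump 0 i)%:Z)); first exact: chargespan_Eplus.
  by rewrite /bump /=; lia.
move: f Sf; apply: lspan_image; [exact: inchargeP | exact: principal_closed |].
move=> _ [[|a t] [st _ ->]] //; case: st => st; rewrite /hprod big_cons -Eminus_incharge.
apply: (top (sumn t).+1 (sumn t)%:Z); last by lia.
by exists (hprod hgen t) => //; rewrite -st; exact: hspan_prod.
Qed.

End Principal.

(** * Elements supported in a given set of basis vectors *)

Section Support.
Context {F : numFieldType} {K : choiceType}.
Implicit Types (D : set K) (f g : {malg F[K]}).

Definition supported D : set {malg F[K]} :=
  [set f | forall k, k \in msupp f -> D k].

Lemma supported_closed D : lclosed (supported D).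
Proof.
split=> [k|a u v Du Dv k]; first by rewrite msupp0.
rewrite -mcoeff_neq0 mcoeffD mcoeffZ.
have [ku|/mcoeff_outdom ->] := boolP (k \in msupp u); first by move=> _; exact: Du.
have [kv|/mcoeff_outdom ->] := boolP (k \in msupp v); first by move=> _; exact: Dv.
by rewrite mulr0 addr0 eqxx.
Qed.

Lemma supportedU D k : D k -> supported D << k >>.
Proof. by move=> Dk k'; rewrite msuppU oner_eq0 inE => /eqP ->. Qed.

Lemma sub_supported D E f : D `<=` E -> supported D f -> supported E f.
Proof. by move=> DE Df k /Df /DE. Qed.

Lemma supported_coef0 D f k : supported D f -> ~ D k -> f@_k = 0.
Proof. by move=> Df nDk; apply: mcoeff_outdom; apply/negP => /Df. Qed.

End Support.

Lemma lin_mul_split (F : numFieldType) (A : comAlgType F) (a b : F) (x y r s : A) :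
  (a *: x + r) * (b *: y + s) = (a * b) *: (x * y) + (r * (b *: y + s) + a *: (x * s)).
Proof.
rewrite mulrDl -[a *: x * _]scalerAl mulrDr -scalerAr scalerDr scalerA -addrA.
by congr (_ + _); rewrite addrC.
Qed.

(** * Leading monomials and linear independence of the H_mu *)

Section Monomials.
Context {F : numFieldType}.
Local Notation M := {malg F[{cmonom nat}]}.
Implicit Types (f g : M) (m : {cmonom nat}).

Definition wt m : nat := \sum_(i <- finsupp m) m i * i.+1.

Lemma wtE m (d : {fset nat}) : (finsupp m `<=` d)%fset ->
  wt m = (\sum_(i <- d) m i * i.+1)%N.
Proof.
move=> le; apply: big_fset_incl => // i _.
by rewrite -cmE_eq0 => /eqP ->; rewrite mul0n.
Qed.

Lemma wtM m m' : wt (mulcm m m') = (wt m + wt m')%N.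
Proof.
have le : (finsupp (mulcm m m') `<=` finsupp m `|` finsupp m')%fset.
  by rewrite -(mdomD m m').
rewrite (wtE le) (wtE (fsubsetUl (finsupp m) (finsupp m'))).
rewrite (wtE (fsubsetUr (finsupp m) (finsupp m'))) -big_split /=.
by apply: eq_bigr => i _; rewrite mulcmE mulnDl.
Qed.

Lemma wt1 : wt (onecm nat) = 0%N.
Proof. by rewrite /wt mdom1 big_seq_fset0. Qed.

Lemma wtU i : wt (ucm i) = i.+1.
Proof. by rewrite /wt mdomU big_seq_fset1 ucmE eqxx mul1n. Qed.

Lemma mdegMc m m' : mdeg (mulcm m m') = (mdeg m + mdeg m')%N.
Proof. exact: mdegM. Qed.

Lemma supportedM (D E G : set {cmonom nat}) f g :
    (forall m m', D m -> E m' -> G (mulcm m m')) ->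
  supported D f -> supported E g -> supported G (f * g).
Proof.
by move=> DEG Df Eg k /msuppM_le [m [m' [mf m'g ->]]]; apply: DEG; [exact: Df|exact: Eg].
Qed.

Lemma supported_tlogpow j p :
  supported [set m | wt m = p /\ mdeg m = j] (tlogpow (@hgen F) j p).
Proof.
elim: j p => [|j IH] p /=.
  case: eqP => [->|_]; last exact: (lclosed0 (supported_closed _)).
  by apply: supportedU; split; [exact: wt1 | exact: mdeg1].
apply: (lclosed_sum (supported_closed _)) => -[[|i] lti] _.
  rewrite mul0r; exact: (lclosed0 (supported_closed _)).
apply: (@supportedM [set m | wt m = i.+1 /\ mdeg m = 1%N]); last exact: IH.
  move=> m m' [wm dm] [wm' dm']; split; last by rewrite mdegMc dm dm'.
  by rewrite wtM wm wm' subnKC // -ltnS.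
apply: (lclosedZ (supported_closed _)); apply: supportedU.
by split; [exact: wtU | exact: mdegU].
Qed.

Lemma supported_hsym p : supported [set m | wt m = p] (hsym (@hgen F) p).
Proof.
apply: (lclosed_sum (supported_closed _)) => j _.
apply: (lclosedZ (supported_closed _)).
by apply: (sub_supported _ (@supported_tlogpow j p)) => m [].
Qed.

Lemma supported_hprod t : supported [set m | wt m = sumn t] (hprod (@hgen F) t).
Proof.
elim: t => [|a t IH]; rewrite /hprod ?big_nil ?big_cons.
  by apply: supportedU; exact: wt1.
apply: (supportedM _ (@supported_hsym a) IH) => m m' wm wm'.
by rewrite /= wtM wm wm'.
Qed.

(** The remainder collects the powers j >= 2, whose monomials have j variables. *)
Lemma hsym_lead i : exists2 r, supported [set m | (1 < mdeg m)%N] r &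
  hsym (@hgen F) i.+1 = i.+1%:R^-1 *: << ucm i >> + r.
Proof.
eexists; last exact: hsymS.
apply: (lclosed_sum (supported_closed _)) => j _.
apply: (lclosedZ (supported_closed _)).
by apply: (sub_supported _ (@supported_tlogpow _ _)) => m [_ /= ->].
Qed.

(** Entries 0 are skipped, matching H_0 = 1, so that this is the shortest monomial of
    [hprod hgen t]. *)
Definition mon (t : seq nat) : {cmonom nat} :=
  foldr (fun a m => if a is i.+1 then mulcm (ucm i) m else m) (onecm nat) t.

Lemma monE t i : mon t i = count_mem i.+1 t.
Proof.
elim: t => [|[|a] t IH] /=; first by rewrite onecmE.
  by rewrite IH.
by rewrite mulcmE ucmE IH eqSS.
Qed.

(** The monomial records the positive entries with multiplicity; equal lengths then force equally
    many zeros, and sorted lists with the same entries coincide. *)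
Lemma mon_inj s t : size s = size t -> sorted leq s -> sorted leq t ->
  mon s = mon t -> s = t.
Proof.
move=> st ss stt eqm; apply: (sorted_eq leq_trans anti_leq) => //.
have cS i : count_mem i.+1 s = count_mem i.+1 t by rewrite -!monE eqm.
have posE (r : seq nat) i : count_mem i.+1 [seq a <- r | (0 < a)%N] = count_mem i.+1 r.
  by rewrite count_filter; apply: eq_count => -[|a] //=; rewrite andbT.
have pos : perm_eq [seq a <- s | (0 < a)%N] [seq a <- t | (0 < a)%N].
  apply/allP => -[|i] /=; last by rewrite !posE cS.
  by rewrite mem_cat !mem_filter.
apply/allP => -[|i] _ /=; last by rewrite cS.
have c0 (r : seq nat) : (count_mem 0 r + size [seq a <- r | (0 < a)%N] = size r)%N.
  rewrite size_filter -(count_predC (pred1 0%N)); congr (_ + _)%N.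
  by apply: eq_count => -[].
by move: (c0 s) (c0 t); rewrite (perm_size pos) st => <- /addIn ->.
Qed.

(** The number of variables is additive under products, so any product involving a remainder from
    [hsym_lead] is longer than the product of the leading terms. *)
Lemma hprod_lead t : exists c r, [/\ c != 0,
  supported [set m | (mdeg (mon t) < mdeg m)%N] r &
  hprod (@hgen F) t = c *: << mon t >> + r].
Proof.
elim: t => [|[|i] t [c [r [c0 Sr tE]]]]; rewrite /hprod ?big_nil ?big_cons -?/(hprod _ _).
- exists 1, 0; split; [exact: oner_neq0|exact: (lclosed0 (supported_closed _))|].
  by rewrite scale1r addr0.
- by exists c, r; split=> //; rewrite hsym0 mul1r.
have [r' Sr' hE] := hsym_lead i.
exists (i.+1%:R^-1 * c), (r' * (c *: << mon t >> + r) + i.+1%:R^-1 *: (<< ucm i >> * r)).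
split; first by rewrite mulf_neq0 // invr_neq0 // pnatr_eq0.
  apply: (lclosedD (supported_closed _)).
    apply: (supportedM _ Sr' (_ : supported [set m | (mdeg (mon t) <= mdeg m)%N] _)).
      by move=> m m' /= lt1 le2; rewrite !mdegMc mdegU -addSn leq_add.
    apply: (lclosedD (supported_closed _)).
      by apply: (lclosedZ (supported_closed _)); apply: supportedU => /=.
    by apply: (sub_supported _ Sr) => m /= /ltnW.
  apply: (lclosedZ (supported_closed _)).
  apply: (supportedM _ (_ : supported [set m | mdeg m = 1%N] _) Sr).
    by move=> m m' /= dm lt; rewrite !mdegMc mdegU dm ltn_add2l.
  by apply: supportedU; exact: mdegU.
rewrite hE tE -[<< mon (i.+1 :: t) >>](malgMUU (ucm i) (mon t)).
exact: lin_mul_split.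
Qed.

Lemma hprod_coef t : (hprod (@hgen F) t)@_(mon t) != 0.
Proof.
have [c [r [c0 Sr ->]]] := hprod_lead t.
rewrite mcoeffD mcoeffZ mcoeffUU mulr1 (supported_coef0 Sr) ?addr0 //=.
by rewrite ltnn.
Qed.

Lemma hprod_coef0 t m : (mdeg m <= mdeg (mon t))%N -> m != mon t ->
  (hprod (@hgen F) t)@_m = 0.
Proof.
have [c [r [c0 Sr ->]]] := hprod_lead t => le ne.
rewrite mcoeffD mcoeffZ mcoeffU eq_sym (negbTE ne) mulr0 (supported_coef0 Sr) ?addr0 //=.
by apply/negP; rewrite -leqNgt.
Qed.

(** Triangularity: among the indices with nonzero coefficient, take k with [mon (t k)] shortest. No
    other product in the sum with nonzero coefficient contains that monomial, so it cannot
    cancel. *)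
Lemma hprod_free n (t : 'I_n -> seq nat) (c : 'I_n -> F) :
    injective (mon \o t) ->
  \sum_i c i *: hprod hgen (t i) = 0 -> forall i, c i = 0.
Proof.
move=> inj sum0 i; apply/eqP/negP => /negP ci.
case: (@arg_minnP _ i (fun i => c i != 0) (fun i => mdeg (mon (t i))) ci) => k ck min.
have /(congr1 (mcoeff (mon (t k)))) := sum0.
rewrite raddf_sum mcoeff0 (bigD1 k) //= big1 => [|l lk].
  rewrite addr0 mcoeffZ => /eqP; rewrite mulf_eq0 (negbTE ck) /=.
  by apply/negP/hprod_coef.
rewrite mcoeffZ; have [->|cl] := eqVneq (c l) 0; first by rewrite mul0r.
rewrite hprod_coef0 ?mulr0 //; first exact: min.
by apply: contra_neq lk => /inj.
Qed.

Lemma coef_incharge c f m : (incharge c f)@_(m, c) = f@_m.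
Proof.
apply: (@eq_malg F _ F^o (fun f => (incharge c f)@_(m, c)) (mcoeff m)).
- by move=> a u v; rewrite inchargeP mcoeffD mcoeffZ.
- by move=> a u v; rewrite mcoeffD mcoeffZ.
by move=> m'; rewrite inchargeU !mcoeffU xpair_eqE eqxx andbT.
Qed.

Lemma incharge_inj c : injective (@incharge F c).
Proof. by move=> f g /malgP e; apply/malgP => m; rewrite -!(coef_incharge c) e. Qed.

Lemma supported_incharge D c f : supported D f ->
  supported [set b | D b.1 /\ b.2 = c] (incharge c f).
Proof.
move=> Df; rewrite /incharge unlock big_seq.
apply: (lclosed_sum (supported_closed _)) => m mf.
apply: (lclosedZ (supported_closed _)); apply: supportedU; split=> //; exact: Df.
Qed.

End Monomials.

(** * Uniqueness of the dimension *)

Section Dimension.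
Context {F : numFieldType} {V : lmodType F}.
Implicit Types (S : set V).

(** Expanding each basis in the other gives matrices of sizes d x d' and d' x d whose product is the
    identity. *)
Lemma has_dim_leq S d d' : has_dim S d -> has_dim S d' -> (d <= d')%N.
Proof.
move=> [b [Sb freeb spanb]] [b' [Sb' freeb' spanb']].
have [B bE] := choice (fun i => spanb' _ (Sb i)).
have [A b'E] := choice (fun i => spanb _ (Sb' i)).
apply: (@mulmx1_min F d d' (\matrix_(i, j) B i j) (\matrix_(i, j) A i j)).
apply/matrixP => i l; rewrite !mxE; apply/eqP; rewrite -subr_eq0; apply/eqP.
move: l; apply: (freeb (fun l => \sum_j _ - _)).
under eq_bigr => l _ do rewrite scalerBl scaler_suml.
rewrite sumrB exchange_big /= [X in X - _](_ : _ = b i).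
  rewrite (bigD1 i) //= eqxx scale1r big1 ?addr0 ?subrr // => l li.
  by rewrite eq_sym (negbTE li) scale0r.
rewrite [RHS]bE; apply: eq_bigr => j _.
by rewrite b'E scaler_sumr; apply: eq_bigr => l _; rewrite !mxE scalerA.
Qed.

Lemma has_dim_uniq S d d' : has_dim S d -> has_dim S d' -> d = d'.
Proof. by move=> Sd Sd'; apply/eqP; rewrite eqn_leq !(has_dim_leq (S := S)). Qed.

Lemma has_dimE S d : has_dim S d -> Defs.dim S = d.
Proof.
move=> Sd; apply: (has_dim_uniq (S := S)) => //; rewrite /Defs.dim.
exact: (@xgetPex _ 0%N [set d | has_dim S d] (ex_intro _ d Sd)).
Qed.

Lemma has_dim0 S : S `<=` [set 0] -> has_dim S 0.
Proof.
move=> S0; exists (fun _ => 0); split=> [[]//|c _ []//|v /S0 ->].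
by exists (fun _ => 0); rewrite big_ord0.
Qed.

End Dimension.

(** * Partitions and the series 1 / (q)_k *)

Section Series.
Implicit Types (p : {poly int}) (b : nat -> int).

(** As the constant term is 1, the equation for N determines [b N] from the earlier values. *)
Lemma invser_uniq p b : p`_0 = 1 ->
    (forall N, \sum_(i < N.+1) p`_i * b (N - i)%N = (N == 0)%:R) ->
  b =1 invser p.
Proof.
move=> p0 bE; elim/ltn_ind => N IH.
have := bE N; rewrite -(invserP N p0) !big_ord_recl /= p0 !mul1r subn0.
rewrite (eq_bigr (fun i : 'I_N => p`_(bump 0 i) * invser p (N - bump 0 i))).
  exact: addIr.
by move=> i _; rewrite IH // /bump; have := ltn_ord i; lia.
Qed.

(** This is 1/p = (1 - X^m) / (p (1 - X^m)), read coefficientwise. *)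
Lemma invser_factor p m N : p`_0 = 1 -> (0 < m)%N ->
  invser p N = invser (p * (1 - 'X^m)) N -
    (if (N < m)%N then 0 else invser (p * (1 - 'X^m)) (N - m)).
Proof.
move=> p0 m0; set p' := p * _.
have p'0 : p'`_0 = 1.
  by rewrite coefM big_ord1 p0 mul1r coefB coef1 coefXn (ltn_eqF m0) subr0.
symmetry; pose b n := invser p' n - (if (n < m)%N then 0 else invser p' (n - m)).
rewrite -/(b N); apply: invser_uniq p0 _ N => N.
(* Only coefficients up to N matter, so a polynomial truncation of 1/p' suffices and associativity
   can be used in polynomials. *)
pose A := \poly_(i < N.+1) invser p' i.
have AE n : (n <= N)%N -> A`_n = invser p' n by move=> nN; rewrite coef_poly ltnS nN.
have bE n : (n <= N)%N -> b n = ((1 - 'X^m) * A)`_n.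
  move=> nN; rewrite mulrBl mul1r coefB coefXnM AE // /b; case: ltnP => // _.
  by rewrite AE // (leq_trans (leq_subr _ _)).
transitivity (p * ((1 - 'X^m) * A))`_N.
  by rewrite coefM; apply: eq_bigr => i _; rewrite bE // leq_subr.
rewrite mulrA -/p' coefM -(invserP N p'0); apply: eq_bigr => i _.
by rewrite AE // leq_subr.
Qed.

Lemma qpochS k : qpoch k.+1 = qpoch k * (1 - 'X^(k.+1)).
Proof. by rewrite /qpoch big_nat_recr. Qed.

Lemma invser_qpoch0 N : invser (qpoch 0) N = (N == 0)%:R.
Proof.
rewrite -(invserP N (qpoch0 0)) big_ord_recl /= qpoch0 mul1r subn0 big1 ?addr0 //.
by move=> i _; rewrite /qpoch big_nil coef1 mul0r.
Qed.

(* Either the smallest of the k + 1 parts is 0 and can be dropped, or every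
   part can be lowered by 1. *)
Lemma partitions_count k N : exists s : seq (seq nat), [/\ uniq s,
  (forall t, (t \in s) = [&& size t == k, sorted leq t & sumn t == N]) &
  (size s)%:Z = invser (qpoch k) N].
Proof.
elim: k N => [|k IHk] N.
  exists (if N == 0%N then [:: [::]] else [::]); rewrite invser_qpoch0; split.
  - by case: eqP.
  - by move=> [|a t]; case: N.
  - by case: eqP.
elim/ltn_ind: N => N IHN; have [s [us sE sN]] := IHk N.
have inj0 : injective (cons 0%N) by move=> ? ? [].
have injS : injective (map succn) by apply: inj_map; exact: succn_inj.
have s0E t : ((0 :: t)%N \in map (cons 0%N) s) =
    [&& size t == k, sorted leq t & sumn t == N].
  by rewrite mem_map.
have sSE a t : (a.+1 :: t \in map (cons 0%N) s) = false.
  by apply/negP => /mapP [].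
have path0 t : path leq 0 t = sorted leq t by case: t.
(* A sorted list with positive head has only positive entries, so each can be lowered by 1. *)
have low a t : path leq a.+1 t -> exists u, t = map succn u.
  move=> /(order_path_min leq_trans) /allP ge.
  by exists (map predn t); rewrite -map_comp map_id_in // => x /ge /=; case: x.
(* The same dichotomy for the series: the coefficient of 1/(q)_(k+1) at N is that of 1/(q)_k at N
   plus that of 1/(q)_(k+1) at N - k - 1, the last being 0 if N < k + 1. *)
have rec := invser_factor N (qpoch0 k) (ltn0Sn k); rewrite -qpochS in rec.
have sumS u : sumn (map succn u) = (sumn u + size u)%N.
  by elim: u => //= x u ->; lia.
have [ltN|leN] := ltnP N k.+1.
  exists (map (cons 0%N) s); split.
  - by rewrite map_inj_uniq.
  - move=> [|[|a] t]; first by apply/mapP => -[].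
      by rewrite s0E /= eqSS path0.
    rewrite sSE; apply/esym/negP => /and3P [/= st /low [u ut]].
    by move: st; rewrite ut size_map sumS; lia.
  - by rewrite size_map sN rec ltN subr0.
have [|s' [us' s'E s'N]] := IHN (N - k.+1)%N; first by lia.
exists (map (cons 0%N) s ++ map (map succn) s'); split.
- rewrite cat_uniq !map_inj_uniq // us us' andbT /=.
  by apply/hasPn => _ /mapP [u _ ->]; apply/mapP => -[v _]; case: u.
- move=> [|[|a] t]; rewrite mem_cat.
  + apply/negbTE; rewrite negb_or; apply/andP; split; apply/mapP => -[u us'' //].
    by case: u us'' => // us''; move: us''; rewrite s'E.
  + rewrite s0E /= eqSS path0 [X in _ || X](_ : _ = false) ?orbF //.
    by apply/mapP => -[[]].
  rewrite sSE /=; apply/mapP/idP => [[[//|b u] us'' [-> ->]]|].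
    move: us''; rewrite s'E /= size_map sumS => /and3P [su pu eN].
    rewrite su path_map /=; apply/andP; split; first exact: pu.
    by move: eN su; lia.
  move=> /and3P [st pt eN]; have [u ut] := low _ _ pt.
  exists (a :: u); last by rewrite ut.
  rewrite s'E /=; move: st pt eN; rewrite ut size_map sumS path_map => su pu eN.
  by rewrite su (_ : path leq a u) //=; move: su eN; lia.
by rewrite size_cat !size_map PoszD sN s'N rec ltnNge leN /= subrK.
Qed.

End Series.

(** * Coefficients of the double series *)

Section ShiftedSum.
Variables (e : nat -> nat) (a : nat -> nat -> int).
Let rhs := xqsum (fun n => xqshift n%:R (e n)%:R (qembed (a n))).

Lemma xqsum_at k N : rhs k%:R ((e k)%:R + N%:R) = a k N.
Proof.
rewrite /rhs /xqsum (fsbigE [:: k]) //.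
  rewrite big_cons big_nil in_setT /= addr0 /xqshift /qembed subrr eqxx.
  by rewrite addrC addKr natr_nat natrK.
move=> n _; rewrite inE /xqshift /qembed subr_eq0 eqr_nat => /negbTE.
by rewrite eq_sym => ->.
Qed.

Lemma xqsum_out r s :
  (forall k N, r = k%:R -> s = (e k)%:R + N%:R -> False) -> rhs r s = 0.
Proof.
move=> out; rewrite /rhs /xqsum fsbig1 // => n _; rewrite /xqshift /qembed.
case: ifP => // /andP [/eqP rn /natrP [N sN]].
case: (out n N); first by apply/eqP; rewrite -subr_eq0 rn.
by rewrite -sN addrC subrK.
Qed.

End ShiftedSum.

(** * Dimensions of the homogeneous components *)

Section Homogeneous.
Context {F : numFieldType}.
Local Notation V := (VP F).
Implicit Types (v : V).

(** The projection onto charge r and weight s. A homogeneous vector may be given as a combination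
    involving words of other degrees, and the projection removes those. *)
Definition hproj (r s : rat) : V -> V :=
  malgext (fun b => if (charge b == r) && (weight b == s) then << b >> else 0).

Lemma hprojP r s a (u v : V) : hproj r s (a *: u + v) = a *: hproj r s u + hproj r s v.
Proof. exact: malgextP. Qed.

Lemma hproj_id r s v : homogeneous r s v -> hproj r s v = v.
Proof.
move=> hv; rewrite [RHS]malg_linE /hproj unlock; apply: eq_big_seq => b /hv [-> ->].
by rewrite !eqxx.
Qed.

Lemma hproj_supported r s (D : set ({cmonom nat} * int)) (v : V) :
    (forall b, D b -> ~ (charge b = r /\ weight b = s)) -> supported D v ->
  hproj r s v = 0.
Proof.
move=> nD Dv; rewrite /hproj unlock big_seq big1 // => b /Dv /nD nb.
case: andP => [[/eqP cb /eqP wb]|_]; last exact: scaler0.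
by case: nb.
Qed.

Lemma chargespan_supported c k d v : chargespan c k d v ->
  supported [set b : {cmonom nat} * int | (wt b.1)%:Z = d /\ b.2 = c] v.
Proof.
move=> [f Sf ->].
apply: (supported_incharge (D := [set m | (wt m)%:Z = d])).
move: f Sf; apply: lspan_ind; first exact: supported_closed.
move=> _ [t [_ <- ->]].
by apply: (sub_supported _ (@supported_hprod _ _)) => m /= ->.
Qed.

(** For lambda = c alpha/2 the lattice part of the weight is <lambda, lambda> / 2 = c^2 / 4. *)
Lemma chargespan_homogeneous c k d v : chargespan c k d v ->
  homogeneous (c%:~R / 2) (d%:~R + c%:~R ^+ 2 / 4) v.
Proof.
move=> /chargespan_supported Sv b /Sv [/= <- <-]; split=> //.
by rewrite /weight -/(wt b.1) /Defs.form; field.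
Qed.

Lemma chargespan_hproj c k d v r s : chargespan c k d v ->
  ~ (r = c%:~R / 2 /\ s = d%:~R + c%:~R ^+ 2 / 4) -> hproj r s v = 0.
Proof.
move=> Sv nrs; have := chargespan_homogeneous Sv; apply: hproj_supported.
by move=> b [-> ->] [rE sE]; apply: nrs.
Qed.

(** Every word is homogeneous, so the projection keeps it or kills it; a homogeneous vector is
    therefore a combination of words of its own charge and weight. *)
Lemma principal_hproj (j : 'I_2) r s (P : set V) : lclosed P ->
    (forall k (d : int) v, chargespan (2 * k + j)%N%:Z k d v -> 0 <= d ->
      r = (2 * k + j)%N%:R / 2 -> s = d%:~R + (2 * k + j)%N%:R ^+ 2 / 4 -> P v) ->
  principal_hom j r s `<=` P.
Proof.
move=> cP sP v [Sv hv]; rewrite -(hproj_id hv) {hv}; move: v Sv; rewrite principalE.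
apply: lspan_image; [exact: hprojP | exact: cP |].
move=> _ [w _ <-]; have [d Sw] := @word_chargespan F j w.
have P0 := lclosed0 cP.
have [[rE sE]|nrs] := pselect (r = (2 * size w + j)%N%:Z%:~R / 2 /\
    s = d%:~R + (2 * size w + j)%N%:Z%:~R ^+ 2 / 4); last first.
  by rewrite (chargespan_hproj Sw nrs).
rewrite hproj_id; last by rewrite rE sE; exact: chargespan_homogeneous Sw.
have [d0|/(chargespan_neg)/(_ Sw) ->] := leP 0 d; last exact: P0.
exact: sP Sw d0 rE sE.
Qed.

(** Source of the exponents n^2 and n^2 + n and of the factor q^(1/4); it uses j^2 = j for j = 0,
    1. *)
Lemma weight_sum (j : 'I_2) (k : nat) : (2 * k + j)%N%:R ^+ 2 / 4 =
  (k ^ 2 + j * k)%N%:R + j%:R / 4 :> rat.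
Proof.
have jj : (j%:R ^+ 2 = j%:R :> rat) by case: j => -[|[|]] //= _; rewrite ?expr1n ?expr0n.
by rewrite -jj !natrD !natrM; field.
Qed.

(** A basis is given by the H_mu at charge k + j/2, with mu running over the sorted lists of k
    naturals with sum N. *)
Lemma principal_hom_dim (j : 'I_2) (k N : nat) :
  exists2 d, d%:Z = invser (qpoch k) N &
    has_dim (principal_hom (F := F) j (k%:R + j%:R / 2)
      ((k ^ 2 + j * k)%N%:R + N%:R + j%:R / 4)) d.
Proof.
have [s [us sE sN]] := partitions_count k N; exists (size s) => //.
set c : int := (2 * k + j)%N%:Z.
have rE : k%:R + j%:R / 2 = c%:~R / 2 :> rat.
  by rewrite /c -pmulrn natrD natrM; field.
have wE : (k ^ 2 + j * k)%N%:R + N%:R + j%:R / 4 = N%:~R + c%:~R ^+ 2 / 4 :> rat.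
  by rewrite /c -!pmulrn weight_sum; ring.
rewrite rE wE; pose t (i : 'I_(size s)) := nth [::] s i.
have tE i : [/\ size (t i) = k, sorted leq (t i) & sumn (t i) = N].
  by have /[!sE]/and3P [/eqP ? ? /eqP ?] := mem_nth [::] (ltn_ord i).
exists (fun i => incharge c (hprod hgen (t i))); split.
- move=> i; have [st _ dt] := tE i.
  have Si : chargespan c k N%:Z (incharge c (hprod (@hgen F) (t i))).
    by exists (hprod hgen (t i)) => //; rewrite -st -dt; exact: hspan_prod.
  split; first exact: chargespan_principal Si.
  exact: chargespan_homogeneous Si.
- move=> x sum0; apply: (@hprod_free F _ t) => [i i' /= e|].
    have [si oi _] := tE i; have [si' oi' _] := tE i'.
    apply/val_inj/eqP; rewrite -(nth_uniq [::] (ltn_ord i) (ltn_ord i') us).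
    by apply/eqP/mon_inj => //; rewrite si.
  apply: (@incharge_inj F c); rewrite incharge0 incharge_sum -[RHS]sum0.
  by apply: eq_bigr => i _; rewrite inchargeZ.
have cspan : lclosed [set v : V | exists x : 'I_(size s) -> F,
    v = \sum_i x i *: incharge c (hprod hgen (t i))].
  split; first by exists (fun _ => 0); rewrite big1 // => i _; exact: scale0r.
  move=> a _ _ [x ->] [y ->]; exists (fun i => a * x i + y i).
  rewrite scaler_sumr -big_split; apply: eq_bigr => i _ /=.
  by rewrite scalerDl scalerA.
apply: (principal_hproj cspan) => k' d v Sv d0 cE dE.
(* The charge determines the number of factors, and then the weight determines the degree. *)
have kk : k' = k.
  move: cE => /(congr1 ( *%R^~ 2)); rewrite !divfK // /c -pmulrn => /eqP.
  by rewrite eqr_nat; lia.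
move: Sv cE dE; rewrite {k'}kk -/c => -[f Sf ->] _.
move=> dE; have {dE} /eqP := addIr (c%:~R ^+ 2 / 4) dE; rewrite eqr_int => /eqP dN.
move: f Sf; apply: lspan_image; [exact: inchargeP | exact: cspan |].
move=> _ [u [su du ->]].
(* The factors commute, so each product equals the one for its sorted list, which is in the
   enumeration. *)
have us' : sort leq u \in s.
  rewrite sE size_sort su eqxx (sort_sorted leq_total) /=.
  rewrite (perm_sumn (_ : perm_eq _ u)) ?perm_sort //.
  by apply/eqP; move: du; rewrite -dN => -[].
have lti : (index (sort leq u) s < size s)%N by rewrite index_mem.
exists (fun i => (i == Ordinal lti)%:R).
rewrite (bigD1 (Ordinal lti)) //= eqxx scale1r big1; last first.
  by move=> i /negbTE ->; exact: scale0r.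
rewrite addr0 /t /= nth_index //; congr incharge.
by apply: perm_big; rewrite perm_sym perm_sort.
Qed.

(** A word is zero or has degree d >= 0, and in the latter case its charge and weight have the
    excluded form with N = d. *)
Lemma principal_hom_out (j : 'I_2) (r s : rat) :
    (forall k N : nat, r = k%:R + j%:R / 2 ->
      s = (k ^ 2 + j * k)%N%:R + N%:R + j%:R / 4 -> False) ->
  has_dim (principal_hom (F := F) j r s) 0.
Proof.
move=> out; apply: has_dim0; apply: principal_hproj.
  by split=> // a u v /= -> ->; rewrite scaler0 addr0.
move=> k [N|//] v _ _ rE sE; case: (out k N).
  by rewrite rE natrD natrM; field.
by rewrite sE weight_sum -pmulrn; ring.
Qed.

(** One formula for both modules: the exponent n^2 + j n and the shifts j/2, j/4 specialize to the
    two cases. *)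
Lemma chiE (j : 'I_2) r s : chi F j r s =
  xqsum (fun n => xqshift n%:R (n ^ 2 + j * n)%N%:R (qembed (invser (qpoch n))))
    (r - j%:R / 2) (s - j%:R / 4).
Proof.
have [[k [N [rE sE]]]|out] := pselect (exists k N : nat, r = k%:R + j%:R / 2 /\
    s = (k ^ 2 + j * k)%N%:R + N%:R + j%:R / 4).
  have [d dE Sd] := principal_hom_dim j k N.
  rewrite /chi rE sE (has_dimE Sd) !addrK dE.
  exact/esym/(xqsum_at (fun n => n ^ 2 + j * n)%N (fun n => invser (qpoch n))).
rewrite /chi (has_dimE (principal_hom_out _)) ; last first.
  by move=> k N rE sE; apply: out; exists k, N.
apply/esym/(@xqsum_out (fun n => n ^ 2 + j * n)%N (fun n => invser (qpoch n))).
move=> k N rE sE; apply: out; exists k, N; split.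
  by rewrite -rE subrK.
by rewrite -sE subrK.
Qed.

(** Rules out the default value of [dim], so that the coefficients of [chi] are genuine
    dimensions. *)
Lemma principal_hom_finite (j : 'I_2) r s :
  finite_dim (principal_hom (F := F) j r s).
Proof.
have [[k [N [-> ->]]]|out] := pselect (exists k N : nat, r = k%:R + j%:R / 2 /\
    s = (k ^ 2 + j * k)%N%:R + N%:R + j%:R / 4).
  by have [d _ Sd] := principal_hom_dim j k N; exists d.
exists 0%N; apply: principal_hom_out => k N rE sE; apply: out; by exists k, N.
Qed.

End Homogeneous.

Theorem corollary4p2 (R : realType) :
  [/\ forall (j : 'I_2) (r s : rat),
        finite_dim (principal_hom (F := R[i]) j r s),
      chi R[i] 0 =
        xqsum (fun n => xqshift n%:R (n ^ 2)%:R (qembed (invser (qpoch n))))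
    & chi R[i] 1 =
        xqshift (1 / 2) (1 / 4)
          (xqsum (fun n =>
             xqshift n%:R (n ^ 2 + n)%:R (qembed (invser (qpoch n)))))].
Proof.
split=> [j r s||]; first exact: principal_hom_finite.
- apply/funext => r; apply/funext => s; rewrite chiE /= mul0r !subr0.
  by congr (xqsum _ r s); apply/funext => n; rewrite addn0.
apply/funext => r; apply/funext => s; rewrite chiE.
have -> : nat_of_ord (1 : 'I_2) = 1%N by [].
apply: (f_equal (fun f => xqsum f (r - 1 / 2) (s - 1 / 4))).
by apply/funext => n; rewrite mul1n.
Qed.
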